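(* Let $N$ be a positive integer, $\boldsymbol{k}=(k_1,\dots,k_r)$ an index and $\boldsymbol{x}=(x_1,\dots,x_r)$ a tuple of indeterminates. Then: (1) Case $i=1$. (a) If $k_1>1$: $\dfrac{\Delta^{(N)}\mathrm{I}_{\boldsymbol{k}}^{(N)}(\boldsymbol{x})}{\Delta^{(N)}x_1}=-\dfrac{1}{x_1}\mathrm{I}_{\boldsymbol{k}^{\downarrow}_1}^{(N)}(\boldsymbol{x})$. (b) If $r=1$ and $k_1=1$: $\dfrac{\Delta^{(N)}\mathrm{I}_{\boldsymbol{k}}^{(N)}(\boldsymbol{x})}{\Delta^{(N)}x_1}=\dfrac{1}{x_1+N^{-1}-1}-\dfrac{1}{x_1}$. (c) If $r>1$ and $k_1=1$: \[\frac{\Delta^{(N)}\mathrm{I}_{\boldsymbol{k}}^{(N)}(\boldsymbol{x})}{\Delta^{(N)}x_1} = -\frac{1}{x_1}\mathrm{I}_{\boldsymbol{k}^{\wedge}_1}^{(N)}(\boldsymbol{x}^{\wedge}_1)+\frac{1}{x_1+N^{-1}-x_2}\left(\mathrm{I}_{\boldsymbol{k}^{\wedge}_1}^{(N)}(\boldsymbol{x}^{\wedge}_1)-\mathrm{I}_{\boldsymbol{k}^{\wedge}_1}^{(N)}(\boldsymbol{x}^{\wedge}_2)\Big|_{x_1+N^{-1}}\right).\] (2) Case $r>1$ and $1<i<r$. (a) If $k_{i-1}>1$, $k_i>1$: \[\frac{\Delta^{(N)}\mathrm{I}_{\boldsymbol{k}}^{(N)}(\boldsymbol{x})}{\Delta^{(N)}x_i}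 = \frac{1}{x_i}\left(\mathrm{I}^{(N)}_{\boldsymbol{k}^{\downarrow}_{i-1}}(\boldsymbol{x})\Big|_{x_i+N^{-1}}-\mathrm{I}^{(N)}_{\boldsymbol{k}^{\downarrow}_i}(\boldsymbol{x})\right).\] (b) If $k_{i-1}>1$, $k_i=1$: \begin{align*} \frac{\Delta^{(N)} \mathrm{I}_{\boldsymbol{k}}^{(N)}(\boldsymbol{x})}{\Delta^{(N)} x_i} &= \frac{1}{x_i}\left(\mathrm{I}_{\boldsymbol{k}_{i-1}^\downarrow}^{(N)}(\boldsymbol{x})\Big|_{x_i+N^{-1}}-\mathrm{I}_{\boldsymbol{k}_i^\wedge}^{(N)}(\boldsymbol{x}_i^\wedge)\right) +\frac{1}{x_i+N^{-1}-x_{i+1}}\left(\mathrm{I}_{\boldsymbol{k}_i^\wedge}^{(N)}(\boldsymbol{x}_i^\wedge) - \mathrm{I}_{\boldsymbol{k}_i^\wedge}^{(N)}(\boldsymbol{x}_{i+1}^\wedge)\Big|_{x_i+N^{-1}}\right)\\ &\quad+\frac{1}{N}\frac{1}{x_i(x_i+N^{-1}-x_{i+1})}\left(\mathrm{I}^{(N)}_{(\boldsymbol{k}_{i-1}^\downarrow)_i^\wedge}(\boldsymbol{x}_{i+1}^\wedge)\Big|_{x_i+N^{-1}} - \mathrm{I}^{(N)}_{(\boldsymbol{k}_{i-1}^\downarrow)_i^\wedge}(\boldsymbol{x}_i^\wedge)\right). \end{align*} (c) If $k_{i-1}=1$, $k_i>1$: \begin{align*} \frac{\Delta^{(N)}\mathrm{I}_{\boldsymbol{k}}^{(N)}(\boldsymbol{x})}{\Delta^{(N)}x_i}&=\frac{1}{x_i-x_{i-1}}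 \left(\mathrm{I}_{\boldsymbol{k}_{i-1}^\wedge}^{(N)}(\boldsymbol{x}_{i-1}^\wedge) - \mathrm{I}_{\boldsymbol{k}_{i-1}^\wedge}^{(N)}(\boldsymbol{x}_i^\wedge) \right) + \frac{1}{x_i} \left(\mathrm{I}_{\boldsymbol{k}_{i-1}^\wedge}^{(N)}(\boldsymbol{x}_i^\wedge) - \mathrm{I}_{\boldsymbol{k}_i^\downarrow}^{(N)}(\boldsymbol{x})\right)\\ &\quad+\frac{1}{N}\frac{1}{x_i(x_i-x_{i-1})}\left(\mathrm{I}_{(\boldsymbol{k}^{\downarrow}_i)^{\wedge}_{i-1}}^{(N)}(\boldsymbol{x}^{\wedge}_i)-\mathrm{I}_{(\boldsymbol{k}^{\downarrow}_i)^{\wedge}_{i-1}}^{(N)}(\boldsymbol{x}^{\wedge}_{i-1})\right). \end{align*} (d) If $k_{i-1}=k_i=1$: \[ \frac{\Delta^{(N)} \mathrm{I}_{\boldsymbol{k}}^{(N)}(\boldsymbol{x})}{\Delta^{(N)} x_i} = \frac{1}{x_i - x_{i-1}} \left(\mathrm{I}_{\boldsymbol{k}_{i-1}^\wedge}^{(N)}(\boldsymbol{x}_{i-1}^\wedge) - \mathrm{I}_{\boldsymbol{k}_i^\wedge}^{(N)} (\boldsymbol{x}_i^\wedge)\right) + \frac{1}{x_i+N^{-1}-x_{i+1}} \left(\mathrm{I}_{\boldsymbol{k}_i^\wedge}^{(N)}(\boldsymbol{x}_i^\wedge) - \mathrm{I}_{\boldsymbol{k}_i^\wedge}^{(N)}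 (\boldsymbol{x}_{i+1}^\wedge)\Big|_{x_i+N^{-1}} \right). \] (3) Case $i=r>1$: the four formulas of (2) hold (with $i=r$) when one sets $x_{r+1}\coloneqq 1$ and interprets the terms $\mathrm{I}_{\boldsymbol{k}_r^\wedge}^{(N)} (\boldsymbol{x}_{r+1}^\wedge)\big|_{x_r+N^{-1}}$ and $\mathrm{I}^{(N)}_{(\boldsymbol{k}_{r-1}^\downarrow)_r^\wedge}(\boldsymbol{x}_{r+1}^\wedge)\big|_{x_r+N^{-1}}$ as $0$.
   Context: An index is a tuple of positive integers. For an index $\boldsymbol{k}=(k_1,\dots,k_r)$ and indeterminates $\boldsymbol{x}=(x_1,\dots,x_r)$, define the rational function \[\mathrm{I}_{\boldsymbol{k}}^{(N)}(\boldsymbol{x})\coloneqq\sum_{\substack{0< n_{j,1}\leq\cdots\leq n_{j,k_j}< N \ (1\leq j\leq r)\\ n_{j,k_j}<n_{j+1,1} \ (1\leq j<r)}}\prod_{j=1}^r\frac{1}{(n_{j,1}-Nx_j)n_{j,2}\cdots n_{j,k_j}},\] the sum over integers $n_{j,l}$. Notation: $\boldsymbol{k}^{\wedge}_{i}=(k_1,\dots,k_{i-1},k_{i+1},\dots,k_r)$ (delete $k_i$); $\boldsymbol{k}^{\downarrow}_{i}=(k_1,\dots,k_{i-1},k_i-1,k_{i+1},\dots,k_r)$ (for $k_i>1$); $\boldsymbol{x}^{\wedge}_{i}=(x_1,\dots,x_{i-1},x_{i+1},\dots,x_r)$; $(\boldsymbol{k}^\downarrow_{a})^\wedge_{b}$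 means first apply $\downarrow$ at position $a$ then delete the entry at position $b$. In each term the index and the tuple of variables have the same length and are fed into the definition above. For a function $f(\boldsymbol{x})$, $\frac{\Delta^{(N)}f(\boldsymbol{x})}{\Delta^{(N)}x_i}\coloneqq N\bigl(f(x_1,\dots,x_i+N^{-1},\dots,x_r)-f(\boldsymbol{x})\bigr)$, and $f\big|_{x_i+N^{-1}}$ denotes $f$ with the variable $x_i$ replaced by $x_i+N^{-1}$ (wherever $x_i$ occurs in it). *)

(* Defs.v *)
From mathcomp Require Import all_boot all_order all_algebra.
From mathcomp Require Export fraction.
From mathcomp.multinomials Require Export mpoly.

Set Implicit Arguments.
Unset Strict Implicit.
Unset Printing Implicit Defensive.

Import GRing.Theory.
Local Open Scope ring_scope.

(* All positions (in indices, in tuples of variables, and inside a block) are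
   0-based: the entry k_i of the usual notation is [nth 0 k (i - 1)]. *)

Definition del (T : Type) (i : nat) (s : seq T) : seq T :=
  take i s ++ drop i.+1 s.

Definition dec (i : nat) (k : seq nat) : seq nat :=
  set_nth 0%N k i (nth 0%N k i).-1.

(* The labels (j, l) of the summation variables n_{j,l}. *)
Definition cell (k : seq nat) : finType :=
  {j : 'I_(size k) & 'I_(nth 0%N k j)}.

Definition mkcell (k : seq nat) (j : 'I_(size k)) (l : 'I_(nth 0%N k j)) :
  cell k := Tagged (fun j : 'I_(size k) => 'I_(nth 0%N k j)) l.

Definition block (k : seq nat) (p : cell k) : nat := tag p.
Definition place (k : seq nat) (p : cell k) : nat := nat_of_ord (tagged p).

(* The upper bound n_{j,l} < N is carried by the type 'I_N. *)
Definition admissible (N : nat) (k : seq nat) (n : {ffun cell k -> 'I_N}) :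
    bool :=
  [&& [forall p : cell k, 0 < n p]%N,
      [forall p : cell k, forall q : cell k,
         (block q == block p) && (place q == (place p).+1)
         ==> (n p <= n q)%N]
    & [forall p : cell k, forall q : cell k,
         [&& block q == (block p).+1,
             (place p).+1 == nth 0%N k (block p)
           & place q == 0%N]
         ==> (n p < n q)%N]].

(* A rational function is handled as a function of a tuple with entries in a
   field; it becomes an element of K(x_1, ..., x_r) at [indets K r] below. *)
Definition Isum (F : fieldType) (N : nat) (k : seq nat) (x : seq F) : F :=
  \sum_(n : {ffun cell k -> 'I_N} | admissible n)
    \prod_(j < size k)
      (\prod_(l < nth 0%N k j)
         (if l == 0%N :> nat then (n (mkcell l))%:R - N%:R * x`_j
          else (n (mkcell l))%:R))^-1.

Definition shift (F : fieldType) (N i : nat) (f : seq F -> F) (x : seq F) : F :=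
  f (set_nth 0 x i (x`_i + N%:R^-1)).

Definition Delta (F : fieldType) (N i : nat) (f : seq F -> F) (x : seq F) : F :=
  N%:R * (shift N i f x - f x).

Definition indets (K : fieldType) (r : nat) :
  r.-tuple {fraction {mpoly K[r]}} := [tuple tofrac 'X_i | i < r].

(* Main.v *)
Require Import Defs.
From mathcomp Require Import all_boot all_order all_algebra.
From mathcomp Require Import ring zify.

(* Summing over the flattened tuple of the n_{j,l} one variable at a time turns
   I_k(x) into a composition of the operators
     g |-> sum_{p < n < N} g(n)/(n - N z)  and  g |-> sum_{p <= n < N} g(n)/n,
   one group of them per block.  Since 1/(n - N (z + 1/N)) is 1/((n - 1) - N z),
   the difference in x_i is a summation by parts inside block i; together with
   partial fractions in n it yields an identity that involves only blocks i - 1,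
   i and i + 1 and holds for every lower bound p.  The blocks before them act
   linearly and preserve it.  What follows block i enters only through
   [tail_shift], which covers i = r as well. *)

Set Implicit Arguments.
Unset Strict Implicit.
Unset Printing Implicit Defensive.

Import GRing.Theory.
Local Open Scope ring_scope.

(** * The two summation operators and the effect of [z] becoming [z + 1/N] *)

Section Operators.

Variables (F : fieldType) (N : nat).
Implicit Types (z y t : F) (g G H : nat -> F) (p n m : nat).

Let h : F := N%:R^-1.

Definition pole z n : F := (n%:R - N%:R * z)^-1.

Definition pole_sum z g p : F := \sum_(p.+1 <= n < N) pole z n * g n.

Definition inv_sum g p : F := \sum_(p <= n < N) n%:R^-1 * g n.

Lemma pole_sum_rec z g p : (p.+1 < N)%N ->
  pole_sum z g p = pole z p.+1 * g p.+1 + pole_sum z g p.+1.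
Proof. by move=> ltpN; rewrite /pole_sum big_ltn. Qed.

Lemma pole_sum_end z g p : (N <= p.+1)%N -> pole_sum z g p = 0.
Proof. by move=> leNp; rewrite /pole_sum big_geq. Qed.

Lemma inv_sum_rec g p : (p < N)%N ->
  inv_sum g p = p%:R^-1 * g p + inv_sum g p.+1.
Proof. by move=> ltpN; rewrite /inv_sum big_ltn. Qed.

Lemma inv_sum_end g p : (N <= p)%N -> inv_sum g p = 0.
Proof. by move=> leNp; rewrite /inv_sum big_geq. Qed.

(** Identities between sums with lower bound [p] are proved downwards: at [N.-1] the sums are empty
    or have a single term, and each step splits off the lowest term. *)
Lemma descending_ind (Q : nat -> Prop) : Q N.-1 ->
  (forall p, (p.+1 < N)%N -> Q p.+1 -> Q p) -> forall p, (p < N)%N -> Q p.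
Proof.
move=> Qlast Qstep p ltpN.
have [d Ed] : exists d, N.-1 = (p + d)%N by exists (N.-1 - p)%N; lia.
elim: d p ltpN Ed => [|d IHd] p ltpN Ed.
  by rewrite addn0 in Ed; rewrite -Ed.
by apply: Qstep; [lia | apply: IHd; lia].
Qed.

Hypothesis natF : forall n, (0 < n)%N -> n%:R != 0 :> F.
Hypothesis N_gt0 : (0 < N)%N.

(** The value [n = 0], outside the range of summation, is included on purpose: it makes [z]
    invertible. *)
Definition no_pole z := forall n, n%:R - N%:R * z != 0.

Lemma no_pole_neq0 z : no_pole z -> z != 0.
Proof.
by move=> /(_ 0%N); apply: contraNneq => ->; rewrite mulr0 subr0.
Qed.

(** Multiplied by [N], the expression is the opposite of the denominator of [pole z N.-1]. *)
Lemma no_pole_neq0_shift z : no_pole z -> z + h - 1 != 0.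
Proof.
move=> /(_ N.-1); apply: contraNneq => /(congr1 ( *%R N%:R)).
rewrite mulr0 mulrBr mulrDr mulfV ?natF // mulr1 => E.
rewrite -oppr_eq0 -E -[in - N%:R](prednK N_gt0) -natr1; apply/eqP; ring.
Qed.

Lemma pole_shift z n : pole (z + h) n.+1 = pole z n.
Proof.
have hN : N%:R != 0 :> F by exact: natF.
by congr (_^-1); rewrite /h -natr1; field.
Qed.

Lemma pole_mulE z n : no_pole z -> n%:R * pole z n = 1 + N%:R * z * pole z n.
Proof. by move=> nz; rewrite /pole; field; exact: nz. Qed.

(** Summation by parts moves the difference of poles onto [inv_sum g], whose increments are
    [g n / n]. Then [N/(n(n - Nz))] splits as [z^-1 (1/(n - Nz) - 1/n)]. The boundary term carries a
    factor [p], so it vanishes at [p = 0]. *)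
Lemma pole_sum_diff z g p : no_pole z -> (p < N)%N ->
  N%:R * (pole_sum (z + h) (inv_sum g) p - pole_sum z (inv_sum g) p) =
  z^-1 * (p%:R * pole z p * inv_sum g p.+1 - pole_sum z g p).
Proof.
move=> nz; move: p; apply: descending_ind => [|p ltpN IH].
  by rewrite !pole_sum_end ?inv_sum_end ?prednK //; ring.
rewrite !(pole_sum_rec _ _ ltpN) pole_shift.
transitivity (N%:R * (pole z p - pole z p.+1) * inv_sum g p.+1
  + z^-1 * (p.+1%:R * pole z p.+1 * inv_sum g p.+2 - pole_sum z g p.+1)).
  by rewrite -IH; ring.
rewrite [inv_sum g p.+1]inv_sum_rec // !(pole_mulE _ nz).
have nz0 := no_pole_neq0 nz; have := natF (ltn0Sn p).
have := nz p; have := nz p.+1; rewrite /pole.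
have -> : p%:R = p.+1%:R - 1 :> F by rewrite -natr1; ring.
move: p.+1%:R => q nq nq1 q0; field; do ?[apply/andP; split=> //].
Qed.

(** The outer weight [1/n] cancels the factor [n] of the boundary term in [pole_sum_diff]. What
    remains, [pole z n * inv_sum g n.+1], is the term of index [n.+1] of the shifted pole sum. *)
Lemma inv_pole_sum_diff z g p : no_pole z -> (0 < p < N)%N ->
  N%:R * (inv_sum (pole_sum (z + h) (inv_sum g)) p
          - inv_sum (pole_sum z (inv_sum g)) p) =
  z^-1 * (pole_sum (z + h) (inv_sum g) p - inv_sum (pole_sum z g) p).
Proof.
move=> nz /andP[p_gt0 ltpN]; move: p ltpN p_gt0.
apply: descending_ind => [p_gt0|p ltpN /(_ isT) IH p_gt0].
  rewrite !(inv_sum_rec _ (_ : (N.-1 < N)%N)) ?prednK //.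
  by rewrite !inv_sum_end ?prednK // !pole_sum_end ?prednK //; ring.
have ltpN' := ltnW ltpN; rewrite !(inv_sum_rec (pole_sum _ _) ltpN').
transitivity (p%:R^-1 * (N%:R * (pole_sum (z + h) (inv_sum g) p
   - pole_sum z (inv_sum g) p)) + z^-1 * (pole_sum (z + h) (inv_sum g) p.+1
   - inv_sum (pole_sum z g) p.+1)); first by rewrite -IH; ring.
rewrite pole_sum_diff // (pole_sum_rec (z + h) _ ltpN) pole_shift.
have np := natF p_gt0; have nz0 := no_pole_neq0 nz.
by field; do ?[apply/andP; split=> //].
Qed.

(** Here the boundary term of [pole_sum_diff] is multiplied by [pole y n], and
    [n/((n - Ny)(n - Nz))] is split into partial fractions. The [1/N] correction comes from
    replacing [inv_sum g n.+1] by [inv_sum g n - g n / n]. *)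
Lemma pole_pole_sum_diff y z g p : no_pole y -> no_pole z -> z - y != 0 ->
  (p < N)%N ->
  N%:R * (pole_sum y (pole_sum (z + h) (inv_sum g)) p
          - pole_sum y (pole_sum z (inv_sum g)) p) =
  (z - y)^-1 * (pole_sum z (inv_sum g) p - pole_sum y (inv_sum g) p)
  + z^-1 * (pole_sum y (inv_sum g) p - pole_sum y (pole_sum z g) p)
  + h * (z * (z - y))^-1 * (pole_sum y g p - pole_sum z g p).
Proof.
move=> ny nz nzy; move: p; apply: descending_ind => [|p ltpN IH].
  by rewrite !pole_sum_end ?prednK //; ring.
rewrite !(pole_sum_rec _ _ ltpN).
transitivity (pole y p.+1 * (N%:R * (pole_sum (z + h) (inv_sum g) p.+1
    - pole_sum z (inv_sum g) p.+1))
  + N%:R * (pole_sum y (pole_sum (z + h) (inv_sum g)) p.+1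
            - pole_sum y (pole_sum z (inv_sum g)) p.+1)); first by ring.
rewrite IH pole_sum_diff // (inv_sum_rec g ltpN).
have nz0 := no_pole_neq0 nz; have := natF (ltn0Sn p).
have nN := natF N_gt0; have := ny p.+1; have := nz p.+1.
rewrite /pole /h; move: p.+1%:R => q nzq nyq q0.
by field; do ?[apply/andP; split=> //].
Qed.

(* [G] is the sum over the variables after the one carrying [z], and [G'] is
   [G] with the variable [t] that follows [z] replaced by [z + h]; when nothing
   follows, [G = 1], [G' = 0] and [t = 1]. *)
Definition tail_shift z t G G' :=
  N%:R * (z + h - t) * pole z N.-1 * G N.-1 = G' N.-1 - G N.-1 /\
  forall p, (p.+1 < N)%N -> N%:R * (z + h - t) * pole z p * (G p - G p.+1)
    = (G' p - G' p.+1) - (G p - G p.+1).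

(** The increments at [p] carry [pole t p.+1] and [pole (z + h) p.+1 = pole z p]; their denominators
    differ by exactly [N (z + h - t)]. *)
Lemma tail_shift_pole_sum z t g : no_pole z -> no_pole t -> z + h - t != 0 ->
  tail_shift z t (pole_sum t g) (pole_sum (z + h) g).
Proof.
move=> nz nt nzt; split=> [|p ltpN].
  by rewrite !pole_sum_end ?prednK //; ring.
rewrite !(pole_sum_rec _ _ ltpN) pole_shift.
have nN := natF N_gt0; have nzp := nz p; have ntp := nt p.+1.
rewrite /pole /h -natr1 in ntp *; move: p%:R nzp ntp => q nzp ntp.
field; do ?[apply/andP; split=> //].
Qed.

(** The constants have no increments, and [N (z + h - 1) = Nz - (N - 1)] settles the end condition.
    This is why the missing next variable counts as 1. *)
Lemma tail_shift1 z : no_pole z -> tail_shift z 1 (fun=> 1) (fun=> 0).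
Proof.
move=> nz; split=> [|p _]; last by ring.
have nN := natF N_gt0; have := nz N.-1.
rewrite /pole /h -subn1 natrB // => nzp; field; do ?[apply/andP; split=> //].
Qed.

(** * Differences when the shifted variable is alone in its block *)

Section Tail.

Variables (z t : F) (G G' : nat -> F).
Hypotheses (nz : no_pole z) (nzt : z + h - t != 0) (GG' : tail_shift z t G G').

(** The left side sums [pole z n * G n] over [p <= n < N]; reindexed, the shifted sum has [G n.+1]
    instead and stops one term earlier. By [tail_shift] the discrepancy telescopes to [G' - G]. *)
Lemma pole_sum_left p : (p < N)%N ->
  pole z p * G p + pole_sum z G p =
  pole_sum (z + h) G p + (N%:R * (z + h - t))^-1 * (G' p - G p).
Proof.
have nN := natF N_gt0; have [Gend Gstep] := GG'.
move: p; apply: descending_ind => [|p ltpN IH].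
  rewrite !pole_sum_end ?prednK // -Gend.
  by rewrite addr0 add0r -[_ * _ * G _]mulrA mulKf // mulf_neq0.
rewrite !(pole_sum_rec _ _ ltpN) pole_shift IH.
have -> : G' p - G p = (G' p.+1 - G p.+1)
   + N%:R * (z + h - t) * pole z p * (G p - G p.+1) by rewrite Gstep //; ring.
set c := N%:R * (z + h - t).
have nc : c != 0 by rewrite mulf_neq0.
by field.
Qed.

Lemma pole_sum_diff1 p : (p < N)%N ->
  N%:R * (pole_sum (z + h) G p - pole_sum z G p) =
  N%:R * pole z p * G p + (z + h - t)^-1 * (G p - G' p).
Proof.
move=> ltpN; have nN := natF N_gt0.
have -> : pole_sum (z + h) G p
  = pole z p * G p + pole_sum z G p + (N%:R * (z + h - t))^-1 * (G p - G' p).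
  by rewrite pole_sum_left //; ring.
move: (nzt); move: (z + h - t) => c nc; field; do ?[apply/andP; split=> //].
Qed.

Lemma inv_pole_sum_diff1 p : (0 < p < N)%N ->
  N%:R * (inv_sum (pole_sum (z + h) G) p - inv_sum (pole_sum z G) p) =
  z^-1 * (pole_sum (z + h) G p - inv_sum G p)
  + (z + h - t)^-1 * (inv_sum G p - inv_sum G' p)
  + h * (z * (z + h - t))^-1 * (G' p - G p).
Proof.
have nN := natF N_gt0; have nz0 := no_pole_neq0 nz.
move=> /andP[p_gt0 ltpN].
have -> : pole_sum (z + h) G p =
  pole z p * G p + pole_sum z G p - (N%:R * (z + h - t))^-1 * (G' p - G p).
  by rewrite pole_sum_left //; ring.
(* In this form, before [pole_sum_left] is applied, both sides are sums over [p <= n < N] and agree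
   term by term. The [1/N] correction arises only in passing back to the shifted pole sum. *)
transitivity (z^-1 * (pole z p * G p + pole_sum z G p - inv_sum G p)
  + (z + h - t)^-1 * (inv_sum G p - inv_sum G' p)); last first.
  move: (nzt); move: (z + h - t) => c nc; rewrite /h.
  by field; do ?[apply/andP; split=> //].
move: p ltpN p_gt0.
have step p : (0 < p)%N -> (p < N)%N ->
   p%:R^-1 * (N%:R * (pole_sum (z + h) G p - pole_sum z G p)) =
   z^-1 * (pole z p * G p - p%:R^-1 * G p)
   + (z + h - t)^-1 * (p%:R^-1 * G p - p%:R^-1 * G' p).
  move=> p_gt0 ltpN; rewrite pole_sum_diff1 // /pole.
  have np := natF p_gt0; have nzp := nz p.
  move: (nzt); move: (z + h - t) => c nc.
  by field; do ?[apply/andP; split=> //].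
apply: descending_ind => [p_gt0|p ltpN /(_ isT) IH p_gt0].
  have ltN : (N.-1 < N)%N by rewrite prednK.
  have := step _ p_gt0 ltN.
  rewrite !(inv_sum_rec _ ltN) !inv_sum_end ?prednK // => E.
  rewrite !addr0 -mulrBr mulrCA E pole_sum_end ?prednK //; ring.
have ltpN' := ltnW ltpN.
rewrite !(inv_sum_rec _ ltpN') [in RHS](pole_sum_rec z G ltpN).
transitivity (p%:R^-1 * (N%:R * (pole_sum (z + h) G p - pole_sum z G p))
  + N%:R * (inv_sum (pole_sum (z + h) G) p.+1 - inv_sum (pole_sum z G) p.+1)).
  by ring.
by rewrite IH step //; ring.
Qed.

(** Term by term from [pole_sum_diff1], using [N pole y n pole z n = (pole z n - pole y n)/(z -
    y)]. *)
Lemma pole_pole_sum_diff1 y p : no_pole y -> z - y != 0 -> (p < N)%N ->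
  N%:R * (pole_sum y (pole_sum (z + h) G) p - pole_sum y (pole_sum z G) p) =
  (z - y)^-1 * (pole_sum z G p - pole_sum y G p)
  + (z + h - t)^-1 * (pole_sum y G p - pole_sum y G' p).
Proof.
move=> ny nzy; move: p; apply: descending_ind => [|p ltpN IH].
  by rewrite !pole_sum_end ?prednK //; ring.
rewrite !(pole_sum_rec _ _ ltpN).
transitivity (
  pole y p.+1 * (N%:R * (pole_sum (z + h) G p.+1 - pole_sum z G p.+1))
  + N%:R * (pole_sum y (pole_sum (z + h) G) p.+1
            - pole_sum y (pole_sum z G) p.+1)); first by ring.
rewrite IH pole_sum_diff1 //.
have := ny p.+1; have := nz p.+1; rewrite /pole.
move: p.+1%:R (z + h - t) nzt => q c nc nzq nyq.
by field; do ?[apply/andP; split=> //].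
Qed.

End Tail.

End Operators.

(** * Labels of the summation variables and their positions in one flat list *)

Section Cells.

Variable k : seq nat.
Hypothesis k_gt0 : all (leq 1) k.
Implicit Types p q : cell k.

Lemma ltn_block p : (block p < size k)%N.
Proof. exact: ltn_ord (tag p). Qed.

Lemma ltn_place p : (place p < nth 0%N k (block p))%N.
Proof. exact: ltn_ord (tagged p). Qed.

Definition flat p : 'I_(sumn k) := Ordinal (flatten_indexP (ltn_place p)).

Definition unflat (i : 'I_(sumn k)) : cell k :=
  mkcell (j := Ordinal (reshape_indexP (ltn_ord i)))
         (Ordinal (reshape_offsetP (ltn_ord i))).

Lemma reshape_index_flat p : reshape_index k (flat p) = block p.
Proof. exact: flatten_indexKl (ltn_place p). Qed.

Lemma reshape_offset_flat p : reshape_offset k (flat p) = place p.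
Proof. exact: flatten_indexKr (ltn_place p). Qed.

Lemma cell_inj p q : block p = block q -> place p = place q -> p = q.
Proof.
case: p q => [j l] [j' l']; rewrite /block /place /= => /val_inj Ej.
by subst j' => /val_inj ->.
Qed.

Lemma unflatK : cancel unflat flat.
Proof. by move=> i; apply: val_inj; exact: reshape_indexK. Qed.

Lemma flatK : cancel flat unflat.
Proof.
move=> p; apply: cell_inj.
  exact: reshape_index_flat.
exact: reshape_offset_flat.
Qed.

Lemma flat_bij : bijective flat.
Proof. by exists unflat; [exact: flatK | exact: unflatK]. Qed.

Lemma nth_gt0 j : (j < size k)%N -> (0 < nth 0%N k j)%N.
Proof. exact: all_nthP. Qed.

Lemma flat_next_place p q :
  block q = block p -> place q = (place p).+1 -> flat q = (flat p).+1 :> nat.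
Proof. by rewrite /= /flatten_index => -> ->; rewrite addnS. Qed.

Lemma flat_next_block p q : block q = (block p).+1 ->
  (place p).+1 = nth 0%N k (block p) -> place q = 0%N ->
  flat q = (flat p).+1 :> nat.
Proof.
rewrite /= /flatten_index => -> Ep ->.
by rewrite (take_nth 0%N (ltn_block p)) sumn_rcons addn0 -addnS Ep.
Qed.

(** Since no block is empty, the position before the first cell of a block is the last cell of the
    block just before it. *)
Lemma flat_nextP p q : flat q = (flat p).+1 :> nat ->
  if place q == 0%N then
    block q = (block p).+1 /\ (place p).+1 = nth 0%N k (block p)
  else block q = block p /\ place q = (place p).+1.
Proof.
rewrite -(reshape_index_flat p) -(reshape_offset_flat p) => E.
have q_gt0 : (0 < flat q)%N by rewrite E.
have {E}-> : flat p = (flat q).-1 :> nat by rewrite E.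
move: (ltn_block q) (ltn_place q) q_gt0 => /=; rewrite /flatten_index.
case: (place q) (block q) => [|c] b ltb ltc /= q_gt0; last first.
  have ltc' := ltnW ltc.
  by rewrite addnS /= -/(flatten_index k b c) flatten_indexKl ?flatten_indexKr.
case: b ltb q_gt0 {ltc} => [|b] ltb /= q_gt0; first by rewrite take0 in q_gt0.
have k_b := nth_gt0 (ltnW ltb).
have -> : (sumn (take b.+1 k) + 0).-1 = flatten_index k b (nth 0%N k b).-1.
  by rewrite addn0 (take_nth 0%N (ltnW ltb)) sumn_rcons /flatten_index; lia.
by rewrite flatten_indexKl ?flatten_indexKr ?prednK.
Qed.

(** The weak and strict inequalities become one condition on neighbours in the flat order, strict
    exactly when a new block starts. *)
Lemma admissible_flatP N (n : {ffun cell k -> 'I_N}) :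
  reflect ((forall p, 0 < n p)%N /\
           forall p q, flat q = (flat p).+1 :> nat ->
             (n p + (place q == 0%N) <= n q)%N)
          (admissible n).
Proof.
apply: (iffP and3P) => [[/forallP n_gt0 nle nlt]|[n_gt0 n_next]].
  split=> // p q /flat_nextP.
  case: ifP => /eqP cq [Eb Ep].
    have /forallP/(_ q)/implyP := forallP nlt p.
    by rewrite addn1; apply; rewrite Eb Ep cq !eqxx.
  have /forallP/(_ q)/implyP := forallP nle p.
  by rewrite addn0; apply; rewrite Eb Ep !eqxx.
split; first exact/forallP.
  apply/forallP => p; apply/forallP => q.
  apply/implyP => /andP[/eqP Eb /eqP Ep].
  by have := n_next p q (flat_next_place Eb Ep); rewrite Ep addn0.
apply/forallP => p; apply/forallP => q.
apply/implyP => /and3P[/eqP Eb /eqP Ep /eqP cq].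
by have := n_next p q (flat_next_block Eb Ep cq); rewrite cq addn1.
Qed.

End Cells.

(** * The multiple sum as an iterated sum *)

Section ChainSum.

Variables (F : fieldType) (N : nat).

(* A link [(b, w)] carries the weight [w] of one summation variable, and [b]
   tells whether that variable is strictly larger than the preceding one. *)
Definition link := (bool * (nat -> F))%type.

Fixpoint chain_sum (ws : seq link) (a : nat) : F :=
  if ws is (b, w) :: ws' then
    \sum_(a + b <= n < N) w n * chain_sum ws' n
  else 1.

Definition chain_step (u v : bool * nat) := (u.2 + v.1 <= v.2)%N.

Lemma sum_tuple_cons (T : finType) m (P : pred (m.+1.-tuple T))
    (Phi : m.+1.-tuple T -> F) :
  \sum_(s | P s) Phi s =
  \sum_(n : T) \sum_(s : m.-tuple T | P (cons_tuple n s)) Phi (cons_tuple n s).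
Proof.
rewrite pair_big_dep /=.
rewrite (reindex (fun ns : T * m.-tuple T => cons_tuple ns.1 ns.2)) //=.
exists (fun s => (thead s, behead_tuple s)) => [[n s] _ | s _] /=.
  by congr (_, _); apply: val_inj.
by rewrite [RHS]tuple_eta; apply: val_inj.
Qed.

(** The flag [b0] is arbitrary, because [chain_step] reads only the flag of its second argument. *)
Lemma chain_sumE (ws : seq link) b0 a :
  chain_sum ws a =
  \sum_(s : (size ws).-tuple 'I_N
          | path chain_step (b0, a) (zip (unzip1 ws) (map val s)))
    \prod_(i < size ws) (nth (false, fun=> 0) ws i).2 (tnth s i).
Proof.
elim: ws b0 a => [|[b w] ws IH] b0 a /=.
  by rewrite (big_pred1 [tuple]) ?big_ord0 // => s; rewrite tuple0 /= !eqxx.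
rewrite sum_tuple_cons /= big_geq_mkord [LHS]big_mkcond /=.
apply: eq_bigr => n _; rewrite /chain_step /=.
case: leqP => _ /=; last by rewrite big_pred0.
rewrite (IH b) big_distrr /=; apply: eq_bigr => s _.
rewrite big_ord_recl tnth0; congr (_ * _); apply: eq_bigr => i _.
by rewrite tnthS.
Qed.

Lemma eq_inv_sum (g g' : nat -> F) : g =1 g' -> inv_sum N g =1 inv_sum N g'.
Proof. by move=> E p; apply: eq_bigr => n _; rewrite E. Qed.

Lemma eq_iter_inv_sum m (g g' : nat -> F) :
  g =1 g' -> iter m (inv_sum N) g =1 iter m (inv_sum N) g'.
Proof. by move=> E; elim: m => //= m; exact: eq_inv_sum. Qed.

(** The final function [g] is a parameter, so that the blocks of a prefix form an operator acting on
    whatever follows them. *)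
Fixpoint block_sum (k : seq nat) (x : seq F) (g : nat -> F) : nat -> F :=
  if k is k1 :: k' then
    pole_sum N (head 0 x) (iter k1.-1 (inv_sum N) (block_sum k' (behead x) g))
  else g.

Definition block_links m z : seq link :=
  (true, pole N z) :: nseq m (false, fun n => n%:R^-1).

Fixpoint links (k : seq nat) (x : seq F) : seq link :=
  if k is k1 :: k' then block_links k1.-1 (head 0 x) ++ links k' (behead x)
  else [::].

Lemma chain_sum_inv m ws :
  chain_sum (nseq m (false, fun n => n%:R^-1) ++ ws) =1
  iter m (inv_sum N) (chain_sum ws).
Proof.
elim: m => //= m IH a; rewrite /inv_sum addn0.
by apply: eq_bigr => n _; rewrite IH.
Qed.

Lemma chain_sum_links k x :
  chain_sum (links k x) =1 block_sum k x (fun=> 1).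
Proof.
elim: k x => //= k1 k IH x a; rewrite /pole_sum addn1.
apply: eq_bigr => n _; rewrite chain_sum_inv; congr (_ * _).
exact: eq_iter_inv_sum.
Qed.

Lemma links_flatten k x :
  links k x =
  flatten (mkseq (fun j => block_links (nth 0%N k j).-1 x`_j) (size k)).
Proof.
elim: k x => //= k1 k IH x; rewrite IH /mkseq /=.
rewrite -[1%N]addn0 iotaDl -map_comp nth0; congr (_ :: _ ++ flatten _).
by apply: eq_map => j /=; rewrite nth_behead.
Qed.

Lemma shape_links k (f : nat -> F) : all (leq 1) k ->
  shape (mkseq (fun j => block_links (nth 0%N k j).-1 (f j)) (size k)) = k.
Proof.
move=> k_gt0; apply: (@eq_from_nth _ 0%N); first by rewrite size_map size_mkseq.
move=> j; rewrite size_map size_mkseq => ltj.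
rewrite (nth_map [::]) ?size_mkseq // nth_mkseq //= size_nseq prednK //.
exact: nth_gt0.
Qed.

Lemma size_links k x : all (leq 1) k -> size (links k x) = sumn k.
Proof. by move=> k_gt0; rewrite links_flatten size_flatten shape_links. Qed.

Lemma nth_links k x (k_gt0 : all (leq 1) k) (p : cell k) :
  nth (false, fun=> 0) (links k x) (flat p) =
  if place p == 0%N then (true, pole N x`_(block p))
  else (false, fun n => n%:R^-1).
Proof.
rewrite links_flatten nth_flatten shape_links //.
rewrite reshape_index_flat reshape_offset_flat nth_mkseq ?ltn_block //.
have := ltn_place p; case: (place p) => //= c ltc.
by rewrite nth_nseq ifT //; lia.
Qed.

(** Starting the chain at 0 expresses [0 < n], as the first link of a nonempty chain is strict. *)
Lemma Isum_block_sum k x : all (leq 1) k ->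
  Isum N k x = block_sum k x (fun=> 1) 0.
Proof.
move=> k_gt0; rewrite -chain_sum_links (chain_sumE _ true) size_links //.
pose ffun_of (s : (sumn k).-tuple 'I_N) : {ffun cell k -> 'I_N} :=
  [ffun p => tnth s (flat p)].
have ffun_of_bij : bijective ffun_of.
  exists (fun n : {ffun cell k -> 'I_N} => [tuple n (unflat i) | i < sumn k]).
    by move=> s; apply: eq_from_tnth => i; rewrite tnth_mktuple ffunE unflatK.
  by move=> n; apply/ffunP => p; rewrite ffunE tnth_mktuple flatK.
rewrite /Isum (reindex ffun_of) /=; last exact: onW_bij.
apply: eq_big => [s|s _].
  set z := zip _ _.
  have size_z : size z = sumn k.
    by rewrite size_zip !size_map size_links // size_tuple minnn.
  have nth_z p :
      nth (false, 0%N) z (flat p) = (place p == 0%N, val (ffun_of s p)).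
    rewrite nth_zip ?size_map ?size_links ?size_tuple //.
    rewrite (nth_map (false, fun=> 0)) ?size_links // nth_links // ffunE.
    rewrite (nth_map (ffun_of s p)) ?size_tuple // -tnth_nth.
    by case: (place p == 0%N).
  have flat_at i : (i < sumn k)%N -> {p : cell k | flat p = i :> nat}.
    by move=> lti; exists (unflat (Ordinal lti)); rewrite unflatK.
  apply/(admissible_flatP k_gt0)/(pathP (false, 0%N))
    => [[n_gt0 n_next] i | z_path].
    rewrite size_z => /[dup] lti /flat_at[q Eq].
    rewrite -[in X in chain_step _ X]Eq nth_z.
    case: i lti Eq => [_ _|i /ltnW/flat_at[p Ep] Eq].
      by rewrite /chain_step /=; case: eqP => // _; exact: n_gt0.
    by rewrite /= -Ep nth_z; apply: n_next; rewrite Eq Ep.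
  have n_next p q : flat q = (flat p).+1 :> nat ->
      (ffun_of s p + (place q == 0%N) <= ffun_of s q)%N.
    move=> E; have := z_path (flat q); rewrite nth_z E size_z -E.
    by rewrite E /= nth_z; apply; rewrite -E.
  (* Positivity is imposed by the chain on the first variable only; it spreads along the flat order
     by monotonicity. *)
  split=> // p; move Ei: (nat_of_ord (flat p)) => i.
  elim: i p Ei => [|i IH] q Eq.
    have := z_path (flat q); rewrite nth_z Eq size_z -Eq => /(_ (ltn_ord _)).
    have -> : place q = 0%N by move: Eq; rewrite /= /flatten_index; lia.
    by rewrite Eq.
  have /ltnW/flat_at[p Ep] : (i.+1 < sumn k)%N by rewrite -Eq.
  apply: leq_trans (IH p Ep) _.
  apply: leq_trans (n_next p q _); first exact: leq_addr.
  by rewrite Eq Ep.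
rewrite (reindex _ (onW_bij _ (flat_bij k))) /=.
pose wt (p : cell k) : F :=
  if place p == 0%N then pole N x`_(block p) (ffun_of s p)
  else (ffun_of s p)%:R^-1.
rewrite (eq_bigr (fun j : 'I_(size k) =>
  \prod_(l < nth 0%N k j) wt (mkcell l))); last first.
  move=> j _; rewrite -prodfV; apply: eq_bigr => l _ /=.
  by rewrite /wt /place /=; case: ifP.
rewrite (@sig_big_dep _ _ _ _ _ xpredT (fun=> xpredT)
  (fun j l => wt (mkcell l))) /=.
apply: eq_bigr => -[j l] _; rewrite nth_links // /wt ffunE.
by case: ifP.
Qed.

End ChainSum.

(** * Editing a list beyond a given prefix *)

Section Surgery.

Variable T : Type.
Implicit Types s : seq T.

Lemma nth_size_cat d s1 s2 j : nth d (s1 ++ s2) (size s1 + j) = nth d s2 j.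
Proof. by rewrite nth_cat ltnNge leq_addr addKn. Qed.

Lemma del_size_cat s1 s2 j : del (size s1 + j) (s1 ++ s2) = s1 ++ del j s2.
Proof. by elim: s1 => //= a s1 IH; rewrite -[in RHS]IH. Qed.

Lemma set_nth_size_cat d s1 s2 j a :
  set_nth d (s1 ++ s2) (size s1 + j) a = s1 ++ set_nth d s2 j a.
Proof. by elim: s1 => //= b s1 ->. Qed.

End Surgery.

Lemma dec_size_cat s1 s2 j : dec (size s1 + j) (s1 ++ s2) = s1 ++ dec j s2.
Proof. by rewrite /dec nth_size_cat set_nth_size_cat. Qed.

(** * Linear relations carried through the summation operators *)

Section Relations.

Variables (F : fieldType) (N : nat).

(** Coefficients are kept apart from functions, so that an operator is applied to a whole relation
    by one [map]. *)
Definition lin_comb (s : seq (F * (nat -> F))) p : F :=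
  \sum_(t <- s) t.1 * t.2 p.

Lemma lin_comb_pole_sum z s p :
  lin_comb [seq (t.1, pole_sum N z t.2) | t <- s] p
    = pole_sum N z (lin_comb s) p.
Proof.
rewrite /lin_comb big_map /=.
under eq_bigr => t _ do rewrite /pole_sum big_distrr /=.
rewrite exchange_big; apply: eq_bigr => n _.
by rewrite big_distrr; apply: eq_bigr => t _; rewrite mulrCA.
Qed.

Lemma lin_comb_inv_sum s p :
  lin_comb [seq (t.1, inv_sum N t.2) | t <- s] p = inv_sum N (lin_comb s) p.
Proof.
rewrite /lin_comb big_map /=.
under eq_bigr => t _ do rewrite /inv_sum big_distrr /=.
rewrite exchange_big; apply: eq_bigr => n _.
by rewrite big_distrr; apply: eq_bigr => t _; rewrite mulrCA.
Qed.

Lemma iter_inv_sum_relation m s :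
  (forall p, (0 < p < N)%N -> lin_comb s p = 0) ->
  forall p, (0 < p < N)%N ->
    lin_comb [seq (t.1, iter m (inv_sum N) t.2) | t <- s] p = 0.
Proof.
move=> s0; elim: m => [|m IH] p lp /=.
  by rewrite -[RHS](s0 p lp) /lin_comb big_map.
rewrite [X in lin_comb X](_ : _ = [seq (t.1, inv_sum N t.2) |
  t <- [seq (t.1, iter m (inv_sum N) t.2) | t <- s]]);
  last by rewrite -map_comp.
rewrite lin_comb_inv_sum /inv_sum big_nat big1 // => n ln.
by rewrite IH ?mulr0 //; lia.
Qed.

(** A pole sum evaluates its argument only at [p < n < N], so a relation known for positive
    arguments yields one that holds at [p = 0] too. *)
Lemma pole_sum_relation m z s :
  (forall p, (0 < p < N)%N -> lin_comb s p = 0) ->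
  forall p, lin_comb
    [seq (t.1, pole_sum N z (iter m (inv_sum N) t.2)) | t <- s] p = 0.
Proof.
move=> s0 p.
rewrite [X in lin_comb X](_ : _ = [seq (t.1, pole_sum N z t.2) |
  t <- [seq (t.1, iter m (inv_sum N) t.2) | t <- s]]);
  last by rewrite -map_comp.
rewrite lin_comb_pole_sum /pole_sum big_nat big1 // => n ln.
by rewrite iter_inv_sum_relation ?mulr0 //; lia.
Qed.

Lemma block_sum_relation k x s : (forall p, (p < N)%N -> lin_comb s p = 0) ->
  forall p, (p < N)%N ->
    lin_comb [seq (t.1, block_sum N k x t.2) | t <- s] p = 0.
Proof.
move=> s0; elim: k x => [|k1 k IH] x p ltpN /=.
  by rewrite -[RHS](s0 p ltpN) /lin_comb big_map.
rewrite [X in lin_comb X](_ : _ =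
  [seq (t.1, pole_sum N (head 0 x) (iter k1.-1 (inv_sum N) t.2)) |
    t <- [seq (t.1, block_sum N k (behead x) t.2) | t <- s]]).
  by rewrite pole_sum_relation // => q /andP[_ ltqN]; exact: IH.
by rewrite -map_comp.
Qed.

Lemma block_sum_cat k1 k2 (x1 x2 : seq F) g : size k1 = size x1 ->
  block_sum N (k1 ++ k2) (x1 ++ x2) g = block_sum N k1 x1 (block_sum N k2 x2 g).
Proof. by elim: k1 x1 => [|a k1 IH] [|y x1] //= [/IH->]. Qed.

End Relations.

(** * The difference formulas behind an arbitrary prefix of blocks *)

Section Formulas.

Variables (F : fieldType) (N : nat).

(** [xnext], [A] and [B] stand for the next variable and the two terms in which it is deleted; the
    last position is the instance [1], [0], [0]. *)
Definition interior_formulas (k : seq nat) (x : seq F) i (xnext A B : F) :=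
  let h : F := N%:R^-1 in
    [/\ (1 < nth 0 k i.-1)%N -> (1 < nth 0 k i)%N ->
        Delta N i (Isum N k) x =
          (x`_i)^-1 * (shift N i (Isum N (dec i.-1 k)) x - Isum N (dec i k) x),
        (1 < nth 0 k i.-1)%N -> nth 0%N k i = 1%N ->
        Delta N i (Isum N k) x =
          (x`_i)^-1 * (shift N i (Isum N (dec i.-1 k)) x
                     - Isum N (del i k) (del i x))
          + (x`_i + h - xnext)^-1 * (Isum N (del i k) (del i x) - A)
          + h * (x`_i * (x`_i + h - xnext))^-1
            * (B - Isum N (del i (dec i.-1 k)) (del i x)),
        nth 0%N k i.-1 = 1%N -> (1 < nth 0 k i)%N ->
        Delta N i (Isum N k) x =
          (x`_i - x`_i.-1)^-1
            * (Isum N (del i.-1 k) (del i.-1 x) - Isum N (del i.-1 k) (del i x))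
          + (x`_i)^-1 * (Isum N (del i.-1 k) (del i x) - Isum N (dec i k) x)
          + h * (x`_i * (x`_i - x`_i.-1))^-1
            * (Isum N (del i.-1 (dec i k)) (del i x)
               - Isum N (del i.-1 (dec i k)) (del i.-1 x))
      & nth 0%N k i.-1 = 1%N -> nth 0%N k i = 1%N ->
        Delta N i (Isum N k) x =
          (x`_i - x`_i.-1)^-1
            * (Isum N (del i.-1 k) (del i.-1 x) - Isum N (del i k) (del i x))
          + (x`_i + h - xnext)^-1 * (Isum N (del i k) (del i x) - A)].

Hypothesis natF : forall n, (0 < n)%N -> n%:R != 0 :> F.
Hypothesis N_gt0 : (0 < N)%N.

Let h : F := N%:R^-1.
Let S : F -> (nat -> F) -> nat -> F := pole_sum N.
Let P : (nat -> F) -> nat -> F := inv_sum N.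

Section Local.

Variables (pk : seq nat) (px : seq F) (y z t : F) (G G' : nat -> F).
Hypotheses (npy : no_pole N y) (npz : no_pole N z) (nzy : z - y != 0).

Local Notation pre g := (block_sum N pk px g 0%N).

(** In these four names the first word tells what happens to the entry before the shifted variable,
    the second what happens to its own entry. *)
Lemma formula_dec_dec a b :
  N%:R * (pre (S y (iter a.+1 P (S (z + h) (iter b.+1 P G))))
          - pre (S y (iter a.+1 P (S z (iter b.+1 P G))))) =
  z^-1 * (pre (S y (iter a P (S (z + h) (iter b.+1 P G))))
          - pre (S y (iter a.+1 P (S z (iter b P G))))).
Proof.
(* The relation [s] is [inv_pole_sum_diff] with all terms on one side; it starts at the last [P] of
   the block of [y], leaving [a] copies of [P] and [S y] to be applied. *)
pose s := [:: (N%:R, P (S (z + h) (iter b.+1 P G)));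
  (- N%:R, P (S z (iter b.+1 P G))); (- z^-1, S (z + h) (iter b.+1 P G));
  (z^-1, P (S z (iter b P G)))].
have s0 p : (0 < p < N)%N -> lin_comb s p = 0.
  move=> lp; rewrite /lin_comb !big_cons big_nil /=.
  have := inv_pole_sum_diff natF N_gt0 (iter b P G) npz lp.
  rewrite -/S -/P => E.
  apply/eqP; rewrite addrA mulNr -mulrBr E; apply/eqP; ring.
have := block_sum_relation pk px
  (fun p _ => pole_sum_relation a y s0 p) N_gt0.
rewrite /lin_comb !big_cons big_nil /= -!iterSr -!iterS => E.
by apply/eqP; rewrite -subr_eq0; apply/eqP; rewrite -[RHS]E; ring.
Qed.

Lemma formula_del_dec b :
  N%:R * (pre (S y (S (z + h) (iter b.+1 P G)))
          - pre (S y (S z (iter b.+1 P G)))) =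
  (z - y)^-1 * (pre (S z (iter b.+1 P G)) - pre (S y (iter b.+1 P G)))
  + z^-1 * (pre (S y (iter b.+1 P G)) - pre (S y (S z (iter b P G))))
  + h * (z * (z - y))^-1 * (pre (S y (iter b P G)) - pre (S z (iter b P G))).
Proof.
set H := iter b P G; rewrite /= -/H.
pose s := [:: (N%:R, S y (S (z + h) (P H))); (- N%:R, S y (S z (P H)));
  (- (z - y)^-1, S z (P H)); ((z - y)^-1 - z^-1, S y (P H));
  (z^-1, S y (S z H)); (- (h * (z * (z - y))^-1), S y H);
  (h * (z * (z - y))^-1, S z H)].
have s0 p : (p < N)%N -> lin_comb s p = 0.
  move=> lp; rewrite /lin_comb !big_cons big_nil /=.
  have := pole_pole_sum_diff natF N_gt0 H npy npz nzy lp.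
  rewrite -/S -/P -/h => E.
  by apply/eqP; rewrite addrA mulNr -mulrBr E; apply/eqP; ring.
have := block_sum_relation pk px s0 N_gt0.
rewrite /lin_comb !big_cons big_nil /= => E.
by apply/eqP; rewrite -subr_eq0; apply/eqP; rewrite -[RHS]E; ring.
Qed.

Hypotheses (nzt : z + h - t != 0) (GG' : tail_shift N z t G G').

Lemma formula_dec_del a :
  N%:R * (pre (S y (iter a.+1 P (S (z + h) G)))
          - pre (S y (iter a.+1 P (S z G)))) =
  z^-1 * (pre (S y (iter a P (S (z + h) G))) - pre (S y (iter a.+1 P G)))
  + (z + h - t)^-1 * (pre (S y (iter a.+1 P G)) - pre (S y (iter a.+1 P G')))
  + h * (z * (z + h - t))^-1
    * (pre (S y (iter a P G')) - pre (S y (iter a P G))).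
Proof.
pose s := [:: (N%:R, P (S (z + h) G)); (- N%:R, P (S z G));
  (- z^-1, S (z + h) G); (z^-1 - (z + h - t)^-1, P G);
  ((z + h - t)^-1, P G'); (- (h * (z * (z + h - t))^-1), G');
  (h * (z * (z + h - t))^-1, G)].
have s0 p : (0 < p < N)%N -> lin_comb s p = 0.
  move=> lp; rewrite /lin_comb !big_cons big_nil /=.
  have := inv_pole_sum_diff1 natF N_gt0 npz nzt GG' lp.
  rewrite -/S -/P -/h => E.
  by apply/eqP; rewrite addrA mulNr -mulrBr E; apply/eqP; ring.
have := block_sum_relation pk px
  (fun p _ => pole_sum_relation a y s0 p) N_gt0.
rewrite /lin_comb !big_cons big_nil /= -!iterSr -!iterS => E.
by apply/eqP; rewrite -subr_eq0; apply/eqP; rewrite -[RHS]E; ring.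
Qed.

Lemma formula_del_del :
  N%:R * (pre (S y (S (z + h) G)) - pre (S y (S z G))) =
  (z - y)^-1 * (pre (S z G) - pre (S y G))
  + (z + h - t)^-1 * (pre (S y G) - pre (S y G')).
Proof.
pose s := [:: (N%:R, S y (S (z + h) G)); (- N%:R, S y (S z G));
  (- (z - y)^-1, S z G); ((z - y)^-1 - (z + h - t)^-1, S y G);
  ((z + h - t)^-1, S y G')].
have s0 p : (p < N)%N -> lin_comb s p = 0.
  move=> lp; rewrite /lin_comb !big_cons big_nil /=.
  have := pole_pole_sum_diff1 natF N_gt0 npz nzt GG' npy nzy lp.
  rewrite -/S -/P -/h => E.
  by apply/eqP; rewrite addrA mulNr -mulrBr E; apply/eqP; ring.
have := block_sum_relation pk px s0 N_gt0.
rewrite /lin_comb !big_cons big_nil /= => E.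
by apply/eqP; rewrite -subr_eq0; apply/eqP; rewrite -[RHS]E; ring.
Qed.

End Local.

Lemma interior_formulas_cat pk px a b k' y z x' t A B (G' : nat -> F)
    (G := block_sum N k' x' (fun=> 1)) :
  size pk = size px -> all (leq 1) (pk ++ [:: a, b & k']) ->
  no_pole N y -> no_pole N z -> z - y != 0 -> z + h - t != 0 ->
  tail_shift N z t G G' ->
  A = block_sum N pk px (S y (iter a.-1 P G')) 0%N ->
  ((1 < a)%N -> B = block_sum N pk px (S y (iter a.-2 P G')) 0%N) ->
  interior_formulas (pk ++ [:: a, b & k']) (px ++ [:: y, z & x']) (size pk).+1
    t A B.
Proof.
move=> Epx; rewrite all_cat /= => /and4P[pk_gt0 a_gt0 b_gt0 k'_gt0].
move=> npy npz nzy nzt GG' -> B_E.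
have IE k2 x2 : all (leq 1) k2 -> Isum N (pk ++ k2) (px ++ x2) =
    block_sum N pk px (block_sum N k2 x2 (fun=> 1)) 0%N.
  by move=> k2_gt0; rewrite Isum_block_sum ?all_cat ?pk_gt0 // block_sum_cat.
have xE j : (px ++ [:: y, z & x'])`_(size pk + j) = [:: y, z & x']`_j.
  by rewrite Epx nth_size_cat.
have dxE j :
    del (size pk + j) (px ++ [:: y, z & x']) = px ++ del j [:: y, z & x'].
  by rewrite Epx del_size_cat.
have sxE j u : set_nth 0 (px ++ [:: y, z & x']) (size pk + j) u
    = px ++ set_nth 0 [:: y, z & x'] j u.
  by rewrite Epx set_nth_size_cat.
have Ej : (size pk).+1.-1 = (size pk + 0)%N by rewrite addn0.
have Ei : (size pk).+1 = (size pk + 1)%N by rewrite addn1.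
rewrite /interior_formulas Ej Ei /Delta /shift !xE !sxE !dxE.
rewrite !dec_size_cat !del_size_cat !nth_size_cat /dec /del /= !drop0 -/h.
split.
- case: a b a_gt0 b_gt0 B_E => [|[|a]] [|[|b]] //= _ _ B_E _ _.
  rewrite !IE //=; exact: formula_dec_dec.
- case: a b a_gt0 b_gt0 B_E => [|[|a]] [|[|b]] //= _ _ B_E _ _.
  rewrite B_E // !IE //=; exact: formula_dec_del.
- case: a b a_gt0 b_gt0 B_E => [|[|a]] [|[|b]] //= _ _ B_E _ _.
  rewrite !IE //=; exact: formula_del_dec.
- case: a b a_gt0 b_gt0 B_E => [|[|a]] [|[|b]] //= _ _ B_E _ _.
  rewrite !IE //=; exact: formula_del_del.
Qed.

Lemma block_sum_zero k x a y :
  block_sum N k x (S y (iter a P (fun=> 0))) 0%N = 0.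
Proof.
have zero p : lin_comb [:: (1, fun=> 0)] p = 0 :> F.
  by rewrite /lin_comb big_seq1 mulr0.
have := block_sum_relation k x
  (fun p _ => pole_sum_relation a y (fun q (_ : (0 < q < N)%N) => zero q) p)
  N_gt0.
by rewrite /lin_comb big_seq1 mul1r.
Qed.

Lemma formula_dec_first k1 k (x : seq F) z : all (leq 1) k -> no_pole N z ->
  (1 < k1)%N ->
  Delta N 0 (Isum N (k1 :: k)) (z :: x)
    = - z^-1 * Isum N (dec 0 (k1 :: k)) (z :: x).
Proof.
case: k1 => [|[|k1]] // k_gt0 npz _; rewrite /Delta /shift /dec /= -/h.
rewrite !Isum_block_sum //= pole_sum_diff // !mul0r; ring.
Qed.

Lemma formula_del_first k z (x : seq F) t (G' : nat -> F)
    (G := block_sum N k x (fun=> 1)) :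
  all (leq 1) k -> no_pole N z -> z + h - t != 0 -> tail_shift N z t G G' ->
  Delta N 0 (Isum N (1%N :: k)) (z :: x) =
    - z^-1 * Isum N k x + (z + h - t)^-1 * (Isum N k x - G' 0%N).
Proof.
move=> k_gt0 npz nzt GG'; rewrite /Delta /shift /= -/h !Isum_block_sum //=.
rewrite (pole_sum_diff1 natF N_gt0 nzt GG') // /pole sub0r invrN -/h.
have nN := natF N_gt0; have nz0 := no_pole_neq0 npz.
by rewrite invfM mulrN mulrA divff // mul1r.
Qed.

End Formulas.

Lemma split_pair (T : Type) i (s : seq T) : (i.+1 < size s)%N ->
  exists p a b s', s = p ++ [:: a, b & s'] /\ size p = i.
Proof.
case: s => [//|d s] lti.
exists (take i (d :: s)), (nth d (d :: s) i), (nth d (d :: s) i.+1),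
  (drop i.+2 (d :: s)).
by rewrite size_takel ?(ltnW (ltnW lti)) // -!drop_nth ?cat_take_drop // ltnW.
Qed.

Section Generic.

Variables (F : fieldType) (N : nat) (k : seq nat) (x : seq F).
Hypothesis natF : forall n, (0 < n)%N -> n%:R != 0 :> F.
Hypothesis N_gt0 : (0 < N)%N.
Hypothesis k_gt0 : all (leq 1) k.
Hypothesis size_x : size x = size k.
Hypothesis npx : forall i, (i < size k)%N -> no_pole N x`_i.
Hypothesis x_neq : forall i, (i.+1 < size k)%N -> x`_i.+1 - x`_i != 0.
Hypothesis x_shift_neq :
  forall i, (i.+1 < size k)%N -> x`_i + N%:R^-1 - x`_i.+1 != 0.

Lemma generic_dec_first : (1 < nth 0 k 0)%N ->
  Delta N 0 (Isum N k) x = - (x`_0)^-1 * Isum N (dec 0 k) x.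
Proof.
case: k x size_x k_gt0 npx => [|k1 k'] [|z x'] //= _ /andP[_ k'_gt0] npz k1_gt1.
exact/(formula_dec_first natF N_gt0)/k1_gt1/(npz 0%N).
Qed.

Lemma generic_del_first1 : size k = 1%N -> nth 0%N k 0 = 1%N ->
  Delta N 0 (Isum N k) x = (x`_0 + N%:R^-1 - 1)^-1 - (x`_0)^-1.
Proof.
case: k x size_x k_gt0 npx => [|k1 [|//]] [|z [|//]] //= _ _.
move=> /(_ 0%N isT) npz _ ->.
rewrite (formula_del_first (t := 1) natF N_gt0 (G' := fun=> 0)) //.
- by rewrite Isum_block_sum //= subr0 !mulr1 addrC.
- exact: no_pole_neq0_shift.
- exact: tail_shift1.
Qed.

Lemma generic_del_first : (1 < size k)%N -> nth 0%N k 0 = 1%N ->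
  Delta N 0 (Isum N k) x =
    - (x`_0)^-1 * Isum N (del 0 k) (del 0 x)
    + (x`_0 + N%:R^-1 - x`_1)^-1
      * (Isum N (del 0 k) (del 0 x)
         - shift N 0 (fun y => Isum N (del 0 k) (del 1 y)) x).
Proof.
case: k x size_x k_gt0 npx x_shift_neq => [|k1 [|k2 k']] [|z [|t x']] //= _.
move=> /andP[_ k'_gt0] npz nzt _ E; rewrite /= in E; rewrite E.
rewrite /shift /del /= !drop0.
rewrite (formula_del_first (t := t) natF N_gt0
  (G' := block_sum N (k2 :: k') (z + N%:R^-1 :: x') (fun=> 1))) //.
- by rewrite -Isum_block_sum.
- exact: (npz 0%N).
- exact: (nzt 0%N).
- apply: tail_shift_pole_sum => //.
  + exact: (npz 0%N).
  + exact: (npz 1%N).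
  + exact: (nzt 0%N).
Qed.

Lemma generic_interior i : (0 < i)%N -> (i.+1 < size k)%N ->
  interior_formulas N k x i x`_i.+1
    (shift N i (fun y => Isum N (del i k) (del i.+1 y)) x)
    (shift N i (fun y => Isum N (del i (dec i.-1 k)) (del i.+1 y)) x).
Proof.
case: i => // j _ ltj.
have [pk [a [b [k' [Ek Epk]]]]] := split_pair (ltnW ltj).
have [px [y [z [x' [Ex Epx]]]]] : exists p a b s',
  x = p ++ [:: a, b & s'] /\ size p = j.
  by apply: split_pair; rewrite size_x ltnW.
have xE l : x`_(j + l) = [:: y, z & x']`_l by rewrite Ex -Epx nth_size_cat.
have [Ex' k'_gt0] : size x' = size k' /\ (0 < size k')%N.
  have := ltj; have := size_x.
  rewrite Ek Ex !size_cat Epk Epx => /addnI[-> ltk'].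
  by split=> //; move: ltk' => /=; lia.
case: k' Ek Ex' k'_gt0 => [//|c k'] Ek; case: x' Ex xE => [//|t x'] Ex xE _ _.
have npy : no_pole N y by have := npx (ltnW (ltnW ltj)); rewrite -(addn0 j) xE.
have npz : no_pole N z by have := npx (ltnW ltj); rewrite -(addn1 j) xE.
have npt : no_pole N t by have := npx ltj; rewrite -(addn2 j) xE.
have nzy : z - y != 0.
  by have := x_neq (ltnW ltj); rewrite -(addn1 j) xE -[in x`_j](addn0 j) xE.
have nzt : z + N%:R^-1 - t != 0.
  by have := x_shift_neq ltj; rewrite -(addn2 j) -(addn1 j) !xE.
have -> : x`_j.+2 = t by rewrite -(addn2 j) xE.
rewrite Ek Ex -Epk /=.
have k_gt0E := k_gt0; rewrite Ek in k_gt0E.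
have Esz : size pk = size px by rewrite Epk.
apply: (interior_formulas_cat natF N_gt0
  (G' := block_sum N (c :: k') (z + N%:R^-1 :: x') (fun=> 1))) => //.
- exact: tail_shift_pole_sum.
- rewrite /shift -(addn1 (size pk)) del_size_cat Esz nth_size_cat.
  rewrite set_nth_size_cat -addnS del_size_cat /del /= !drop0.
  rewrite Isum_block_sum ?block_sum_cat //.
  by move: k_gt0E; rewrite !all_cat /= => /and5P[-> -> _ -> ->].
- move=> a_gt1; rewrite /shift -(addn1 (size pk)) -[in dec _](addn0 (size pk)).
  rewrite dec_size_cat del_size_cat Esz nth_size_cat set_nth_size_cat -addnS.
  rewrite del_size_cat /dec /del /= !drop0 Isum_block_sum ?block_sum_cat //.
  move: k_gt0E; rewrite !all_cat /= => /and5P[-> _ _ -> ->].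
  by rewrite -subn1 subn_gt0 a_gt1.
Qed.

Lemma generic_last : (1 < size k)%N ->
  interior_formulas N k x (size k).-1 1 0 0.
Proof.
case Ej: (size k) => [|[|j]] // _.
have ltj : (j.+1 < size k)%N by rewrite Ej.
have [pk [a [b [k' [Ek Epk]]]]] := split_pair ltj.
have [px [y [z [x' [Ex Epx]]]]] : exists p a b s',
  x = p ++ [:: a, b & s'] /\ size p = j by apply: split_pair; rewrite size_x.
have xE l : x`_(j + l) = [:: y, z & x']`_l by rewrite Ex -Epx nth_size_cat.
have [Ex' k'0] : size x' = size k' /\ size k' = 0%N.
  have := Ej; have := size_x; rewrite Ek Ex !size_cat Epk Epx => /addnI[-> Ek'].
  by split=> //; move: Ek' => /=; lia.
case: k' Ek Ex' k'0 => [|//] Ek; case: x' Ex xE => [|//] Ex xE _ _.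
have npy : no_pole N y by have := npx (ltnW ltj); rewrite -(addn0 j) xE.
have npz : no_pole N z by have := npx ltj; rewrite -(addn1 j) xE.
have nzy : z - y != 0.
  by have := x_neq ltj; rewrite -(addn1 j) xE -[in x`_j](addn0 j) xE.
rewrite Ek Ex -Epk /=.
have k_gt0E := k_gt0; rewrite Ek in k_gt0E.
have Esz : size pk = size px by rewrite Epk.
apply: (interior_formulas_cat natF N_gt0 (G' := fun=> 0)) => //.
- exact: no_pole_neq0_shift.
- exact: tail_shift1.
- by rewrite block_sum_zero.
- by rewrite block_sum_zero.
Qed.

End Generic.

Section Indeterminates.

Variables (K : fieldType) (r N : nat).
Hypothesis charK0 : [pchar K] =i pred0.
Hypothesis N_gt0 : (0 < N)%N.

Local Notation FF := {fraction {mpoly K[r]}}.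

Lemma natr_neq0_pchar0 n : (0 < n)%N -> n%:R != 0 :> K.
Proof. by move=> n_gt0; have /pcharf0P-> := charK0; rewrite -lt0n. Qed.

Lemma tofrac_neq0 (v : 'I_r -> K) (p : {mpoly K[r]}) :
  p.@[v] != 0 -> tofrac p != 0.
Proof.
by apply: contraNneq => /eqP; rewrite tofrac_eq0 => /eqP->; rewrite meval0.
Qed.

Lemma nat_fracE n : n%:R = tofrac n%:R :> FF.
Proof. by rewrite rmorph_nat. Qed.

Lemma nat_frac n : (0 < n)%N -> n%:R != 0 :> FF.
Proof.
move=> n_gt0; rewrite nat_fracE.
by apply: (@tofrac_neq0 (fun=> 0)); rewrite rmorph_nat natr_neq0_pchar0.
Qed.

Lemma nth_indets (i : 'I_r) : (indets K r)`_i = tofrac 'X_i.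
Proof. by rewrite -tnth_nth tnth_mktuple. Qed.

Lemma no_pole_indets (i : 'I_r) : no_pole N (indets K r)`_i.
Proof.
move=> n; rewrite nth_indets !nat_fracE -tofracM -tofracB.
case: n => [|n].
  apply: (@tofrac_neq0 (fun=> 1)).
  by rewrite rmorphB rmorphM /= !rmorph_nat mevalXU mulr1 sub0r oppr_eq0 natr_neq0_pchar0.
apply: (@tofrac_neq0 (fun=> 0)).
by rewrite rmorphB rmorphM /= !rmorph_nat mevalXU mulr0 subr0 natr_neq0_pchar0.
Qed.

Lemma indets_neq (i j : 'I_r) : i != j ->
  (indets K r)`_i - (indets K r)`_j != 0.
Proof.
move=> neq_ij; rewrite !nth_indets -tofracB.
apply: (@tofrac_neq0 (fun l => (l == i)%:R)).
rewrite rmorphB /= !mevalXU eqxx [j == i]eq_sym (negPf neq_ij).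
by rewrite subr0 oner_eq0.
Qed.

Lemma indets_shift_neq (i j : 'I_r) :
  (indets K r)`_i + N%:R^-1 - (indets K r)`_j != 0.
Proof.
have nN := nat_frac N_gt0.
suff: N%:R * ((indets K r)`_i + N%:R^-1 - (indets K r)`_j) != 0.
  by apply: contraNneq => ->; rewrite mulr0.
rewrite mulrBr mulrDr mulfV // !nth_indets.
rewrite !nat_fracE -!tofracM -tofrac1 -tofracD -tofracB.
apply: (@tofrac_neq0 (fun=> 0)).
rewrite rmorphB rmorphD !rmorphM /= rmorph1 !mevalXU.
by rewrite !mulr0 add0r subr0 oner_eq0.
Qed.

End Indeterminates.

Theorem theorem1p4 (K : fieldType) (charK0 : [pchar K] =i pred0)
  (N r : nat) (k : r.-tuple nat) (N_gt0 : (0 < N)%N)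
  (k_gt0 : forall i : 'I_r, (0 < tnth k i)%N) :
  let x : seq {fraction {mpoly K[r]}} := indets K r in
  let h : {fraction {mpoly K[r]}} := N%:R^-1 in
  let interior_formulas (i : nat) (xnext A B : {fraction {mpoly K[r]}}) :=
    [/\ (1 < nth 0 k i.-1)%N -> (1 < nth 0 k i)%N ->
        Delta N i (Isum N k) x =
          (x`_i)^-1 * (shift N i (Isum N (dec i.-1 k)) x - Isum N (dec i k) x),
        (1 < nth 0 k i.-1)%N -> nth 0%N k i = 1%N ->
        Delta N i (Isum N k) x =
          (x`_i)^-1 * (shift N i (Isum N (dec i.-1 k)) x
                     - Isum N (del i k) (del i x))
          + (x`_i + h - xnext)^-1 * (Isum N (del i k) (del i x) - A)
          + h * (x`_i * (x`_i + h - xnext))^-1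
            * (B - Isum N (del i (dec i.-1 k)) (del i x)),
        nth 0%N k i.-1 = 1%N -> (1 < nth 0 k i)%N ->
        Delta N i (Isum N k) x =
          (x`_i - x`_i.-1)^-1
            * (Isum N (del i.-1 k) (del i.-1 x) - Isum N (del i.-1 k) (del i x))
          + (x`_i)^-1 * (Isum N (del i.-1 k) (del i x) - Isum N (dec i k) x)
          + h * (x`_i * (x`_i - x`_i.-1))^-1
            * (Isum N (del i.-1 (dec i k)) (del i x)
               - Isum N (del i.-1 (dec i k)) (del i.-1 x))
      & nth 0%N k i.-1 = 1%N -> nth 0%N k i = 1%N ->
        Delta N i (Isum N k) x =
          (x`_i - x`_i.-1)^-1
            * (Isum N (del i.-1 k) (del i.-1 x) - Isum N (del i k) (del i x))
          + (x`_i + h - xnext)^-1 * (Isum N (del i k) (del i x) - A)] in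
  [/\ (* first variable *)
      [/\ (1 < nth 0 k 0)%N ->
          Delta N 0 (Isum N k) x = - (x`_0)^-1 * Isum N (dec 0 k) x,
          r = 1%N -> nth 0%N k 0 = 1%N ->
          Delta N 0 (Isum N k) x = (x`_0 + h - 1)^-1 - (x`_0)^-1
        & (1 < r)%N -> nth 0%N k 0 = 1%N ->
          Delta N 0 (Isum N k) x =
            - (x`_0)^-1 * Isum N (del 0 k) (del 0 x)
            + (x`_0 + h - x`_1)^-1
              * (Isum N (del 0 k) (del 0 x)
                 - shift N 0 (fun y => Isum N (del 0 k) (del 1 y)) x)],
      (* interior variables *)
      (forall i : nat, (0 < i)%N -> (i.+1 < r)%N ->
        interior_formulas i x`_i.+1
          (shift N i (fun y => Isum N (del i k) (del i.+1 y)) x)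
          (shift N i (fun y => Isum N (del i (dec i.-1 k)) (del i.+1 y)) x))
    & (* last variable *)
      ((1 < r)%N -> interior_formulas r.-1 1 0 0)].
Proof.
move=> x h F1.
have {F1}-> : F1 = interior_formulas N k x by [].
have k_gt0' : all (leq 1) k.
  by apply/(all_tnthP).
have size_x : size x = size k by rewrite !size_tuple.
have natF := nat_frac r charK0; have Er := size_tuple k.
have npx i : (i < size k)%N -> no_pole N x`_i.
  rewrite size_tuple => lti.
  exact: (no_pole_indets charK0 N_gt0 (Ordinal lti)).
have x_neq i : (i.+1 < size k)%N -> x`_i.+1 - x`_i != 0.
  rewrite size_tuple => lti.
  apply: (@indets_neq K r (Ordinal lti) (Ordinal (ltnW lti))).
  by rewrite -val_eqE /= gtn_eqF.
have x_shift_neq i : (i.+1 < size k)%N -> x`_i + h - x`_i.+1 != 0.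
  rewrite size_tuple => lti.
  exact: (indets_shift_neq charK0 N_gt0 (Ordinal (ltnW lti)) (Ordinal lti)).
split.
- split.
  + exact: generic_dec_first.
  + by move=> r1; apply: generic_del_first1 => //; rewrite size_tuple.
  + by move=> r1; apply: generic_del_first => //; rewrite size_tuple.
- move=> i i_gt0 lti; have lti' : (i.+1 < size k)%N by rewrite Er.
  exact (generic_interior natF N_gt0 k_gt0' size_x npx x_neq x_shift_neq
    i_gt0 lti').
- move=> r_gt1; have k_gt1 : (1 < size k)%N by rewrite Er.
  have := generic_last natF N_gt0 k_gt0' size_x npx x_neq k_gt1.
  by rewrite Er.
Qed.
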